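(* Given a second-order channel model $\{(m_S,v_S^2): S\subseteq\{1,\dots,N\}\}$, a second-order delivery model $\{(\mu_i,\sigma_i^2): 1\le i\le N\}$ (with $\mu_i$ real and $\sigma_i^2\ge 0$ real) can be in the second-order capacity region only if $$\sum_{i\in S}\mu_i\le m_S\quad\text{for all } S\subseteq\{1,\dots,N\},$$ $$\sum_{i=1}^N\mu_i=m_{\{1,2,\dots,N\}},$$ $$\sum_{i=1}^N\sqrt{\sigma_i^2}\ \ge\ \sqrt{v_{\{1,2,\dots,N\}}^2},$$ $$\mu_i\ge 0\quad\text{for all } i.$$
   Context: An access point (AP) serves $N$ clients $1,\dots,N$ in slotted time $t=1,2,3,\dots$. Let $X_i(t)\in\{0,1\}$ indicate that the channel of client $i$ is ON at time $t$. The channels are governed by Markov processes: the vector $(X_1(t),\dots,X_N(t))$ is a function of the state of an irreducible, positive-recurrent, finite-state Markov chain whose evolution is not affected by scheduling decisions. For $S\subseteq\{1,\dots,N\}$, $X_S(t):=\max\{X_i(t): i\in S\}$ (with $X_\emptyset\equiv 0$). The mean is $m_S:=\lim_{T\to\infty}\frac1T\sum_{t=1}^TX_S(t)$ (almost sure limit, a constant), and the temporal variance is $v_S^2:=E\big[\big(\lim_{T\to\infty}\frac{\sum_{t=1}^TX_S(t)-Tm_S}{\sqrt T}\big)^2\big]$, where the limit is in distribution (it exists and is Gaussian, possibly degenerate), i.e. $v_S^2$ is the second moment of the limiting law. The collection $\{(m_S,v_S^2)\}$ is the second-order channel model. Scheduling policy: in each slot $t$ in which at least one client has an ON channel, the AP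 selects exactly one client with an ON channel and transmits a packet to it, which that client receives; if no channel is ON nothing is transmitted. Let $Z_i(t)\in\{0,1\}$ indicate that client $i$ receives a packet at time $t$. Second-order capacity region: the set of all $\{(\mu_i,\sigma_i^2): 1\le i\le N\}$ for which there exists a scheduling policy under which, for every $i$, $\lim_{T\to\infty}\frac1T\sum_{t=1}^TZ_i(t)=\mu_i$ (almost surely) and $E\big[\big(\lim_{T\to\infty}\frac{\sum_{t=1}^TZ_i(t)-T\mu_i}{\sqrt T}\big)^2\big]\le\sigma_i^2$, where the limit is understood in distribution (and exists), so the left side is the second moment of the limiting law. *)

(* Defs.v *)
(* MathComp-Analysis. *)
From HB Require Import structures.
From mathcomp Require Import all_boot all_order all_algebra.
From mathcomp Require Import all_classical all_reals all_analysis.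

Set Implicit Arguments.
Unset Strict Implicit.
Unset Printing Implicit Defensive.

Import Order.TTheory GRing.Theory Num.Theory.
Import numFieldNormedType.Exports.

Local Open Scope classical_set_scope.
Local Open Scope ring_scope.

(* Slots are numbered t = 1, 2, 3, ...: a process is indexed by [nat], and its
   value at index 0 is never used.  Clients are numbered by ['I_N], and subsets
   of clients are [{set 'I_N}]. *)

Section FiniteMarkovChains.
Context {R : realType} {k : nat}.
Implicit Type Q : 'M[R]_k.

Definition stochastic Q :=
  (forall x y, 0 <= Q x y) /\ (forall x, \sum_y Q x y = 1).

Definition irreducible Q := forall x y, exists n : nat, 0 < (Q ^+ n) x y.

(* Q with the transitions into x removed. *)
Definition taboo Q (x : 'I_k) : 'M[R]_k :=
  \matrix_(i, j) (if j == x then 0 else Q i j).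

(* Probability that the chain started at x first returns to x at step n.+1. *)
Definition first_return Q (x : 'I_k) (n : nat) : R :=
  ((taboo Q x) ^+ n *m Q) x x.

(* Return is certain and the mean return time is finite. *)
Definition positive_recurrent Q := forall x,
  (series (first_return Q x) @ \oo --> (1 : R)) /\
  cvgn (series (fun n => n.+1%:R * first_return Q x n)).

(* Y 1, Y 2, ... is a Markov chain with transition matrix Q; the law of Y 1 is
   arbitrary.  The second clause is
   P(Y_{t+1} = x_{t+1} | Y_1 = x_1, ..., Y_t = x_t) = Q(x_t, x_{t+1}),
   multiplied out so as to allow null conditioning events. *)
Definition markov_chain {d} {Omega : measurableType d} (P : probability Omega R)
    Q (Y : nat -> Omega -> 'I_k) :=
  (forall t x, (0 < t)%N -> measurable [set w | Y t w = x]) /\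
  (forall t (x : nat -> 'I_k), (0 < t)%N ->
     P [set w | forall s, (1 <= s <= t.+1)%N -> Y s w = x s] =
     (P [set w | forall s, (1 <= s <= t)%N -> Y s w = x s] *
      (Q (x t) (x t.+1))%:E)%E).

End FiniteMarkovChains.

Section LimitLaws.
Context {d : measure_display} {Omega : measurableType d} {R : realType}.
Variable P : probability Omega R.

Definition cvg_in_distribution (V : nat -> Omega -> R)
    (nu : probability (measurableTypeR R) R) :=
  forall f : R -> R, continuous f -> bounded_fun f ->
    (\int[P]_w (f (V n w))%:E)%E @[n --> \oo] --> (\int[nu]_x (f x)%:E)%E.

Definition second_moment (nu : probability (measurableTypeR R) R) : \bar R :=
  (\int[nu]_x (x ^+ 2)%:E)%E.

Definition time_average_cvg (U : nat -> Omega -> R) (m : R) :=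
  {ae P, forall w, (\sum_(1 <= t < T.+1) U t w) / T%:R @[T --> \oo] --> m}.

Definition normalized_sum (U : nat -> Omega -> R) (m : R) (T : nat) (w : Omega)
    : R :=
  (\sum_(1 <= t < T.+1) U t w - T%:R * m) / Num.sqrt T%:R.

End LimitLaws.

Section Network.
Context {d : measure_display} {Omega : measurableType d} {R : realType}.
Variable P : probability Omega R.
Context {N : nat}.
(* X i t w: the channel of client i is ON in slot t. *)
Implicit Type X : 'I_N -> nat -> Omega -> bool.

Definition markov_channels X :=
  exists (k : nat) (Q : 'M[R]_k) (Y : nat -> Omega -> 'I_k)
         (on : 'I_k -> 'I_N -> bool),
    [/\ stochastic Q, irreducible Q, positive_recurrent Q,
        markov_chain P Q Y &
        forall i t w, (0 < t)%N -> X i t w = on (Y t w) i].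

Definition some_on X (S : {set 'I_N}) (t : nat) (w : Omega) : R :=
  (\max_(i in S) (X i t w : nat))%:R.

(* Limits in distribution are unique, so m and v2 are determined by X. *)
Definition second_order_channel_model X (m v2 : {set 'I_N} -> R) :=
  forall S : {set 'I_N},
    time_average_cvg P (some_on X S) (m S) /\
    exists nu, cvg_in_distribution P (normalized_sum (some_on X S) (m S)) nu /\
               second_moment nu = (v2 S)%:E.

(* a t w is the client to which a packet is transmitted in slot t, if any.
   The channels are fixed processes on Omega, hence unaffected by a.  The
   decisions may depend on w arbitrarily, in particular on the past and on any
   extra randomness carried by Omega; causality is not imposed. *)
Definition scheduling_policy X (a : nat -> Omega -> option 'I_N) :=
  (forall t o, (0 < t)%N -> measurable [set w | a t w = o]) /\
  (forall t w, (0 < t)%N ->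
     match a t w return Prop with
     | Some i => X i t w
     | None => forall i, ~~ X i t w
     end).

Definition received (a : nat -> Omega -> option 'I_N) (i : 'I_N) (t : nat)
    (w : Omega) : R :=
  (a t w == Some i)%:R.

Definition second_order_capacity_region X : set (('I_N -> R) * ('I_N -> R)) :=
  [set p | exists a, scheduling_policy X a /\ forall i : 'I_N,
    time_average_cvg P (received a i) (p.1 i) /\
    exists nu, cvg_in_distribution P (normalized_sum (received a i) (p.1 i)) nu
               /\ (second_moment nu <= (p.2 i)%:E)%E].

End Network.

(* Main.v *)
(* In every slot the deliveries to the clients of S add up to at most X_S, with
   equality for the full set; averaging over time gives the conditions on means.
   The variance condition is Minkowski's inequality for the limit laws.  These
   need not have a joint limit, and second moments need not pass to the limit,
   so one works with the bounded continuous functions min(|x|, K)^2: since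
   min(|x|, K) is subadditive, a weighted Cauchy-Schwarz inequality with weights
   c_i > sqrt(sigma_i^2) bounds min(|W|, K)^2, for W the sum of the normalized
   deliveries U_i, by a combination of the min(|U_i|, K)^2.  Then T, K tend to
   infinity, and c_i to sqrt(sigma_i^2). *)
Require Import Defs.
From mathcomp Require Import all_boot all_order all_algebra.
From mathcomp Require Import all_classical all_reals all_analysis.
From mathcomp Require Import measurable_realfun ring lra.
Import Order.TTheory GRing.Theory Num.Theory.
Import numFieldNormedType.Exports.
Local Open Scope classical_set_scope.
Local Open Scope ring_scope.

(** * Weighted Cauchy-Schwarz inequality *)

Lemma sqr_sum_le_weighted (R : realFieldType) (I : finType) (c x : I -> R) :
  (forall i, 0 < c i) ->
  (\sum_i x i) ^+ 2 <= \sum_i (\sum_j c j) / c i * x i ^+ 2.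
Proof.
move=> c_gt0.
pose F i j := c j / c i * x i ^+ 2.
have -> : \sum_i (\sum_j c j) / c i * x i ^+ 2 = \sum_i \sum_j F i j.
  by apply: eq_bigr => i _; rewrite mulr_suml mulr_suml.
(* Doubling allows symmetrization: [F i j + F j i] is compared with [2 * x i * x j] pair by pair,
   and the difference is a nonnegative multiple of a square. *)
suff : (\sum_i x i) ^+ 2 *+ 2 <= (\sum_i \sum_j F i j) *+ 2.
  by rewrite ler_pMn2r.
rewrite [leRHS]mulr2n {2}exchange_big -big_split /= expr2 mulr_suml -sumrMnl.
apply: ler_sum => i _; rewrite mulr_sumr -sumrMnl -big_split /=.
apply: ler_sum => j _; rewrite /F -subr_ge0.
have ci := c_gt0 i; have cj := c_gt0 j.
have -> : c j / c i * x i ^+ 2 + c i / c j * x j ^+ 2 - x i * x j *+ 2 =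
    c i * c j * (x i / c i - x j / c j) ^+ 2.
  by field; rewrite !gt_eqF.
by rewrite mulr_ge0 ?sqr_ge0 // mulr_ge0 ?ltW.
Qed.

(** * Truncation and second moments *)

Definition truncation {R : realType} (K x : R) : R := Num.min `|x| K.

Section Truncation.
Variables (R : realType) (K : R).
Hypothesis K_ge0 : 0 <= K.

Lemma truncation_ge0 (x : R) : 0 <= truncation K x.
Proof. by rewrite /truncation le_min normr_ge0. Qed.

Lemma truncation_le (x : R) : truncation K x <= K.
Proof. by rewrite /truncation ge_min lexx orbT. Qed.

Lemma truncation_sqr_le (x : R) : truncation K x ^+ 2 <= x ^+ 2.
Proof.
rewrite -(real_normK (num_real x)) ler_sqr ?nnegrE ?truncation_ge0//.
by rewrite /truncation ge_min lexx.
Qed.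

Lemma truncation_sum (I : finType) (x : I -> R) :
  truncation K (\sum_i x i) <= \sum_i truncation K (x i).
Proof.
elim/big_ind2 : _ => [|u a v b ua vb|//].
  by rewrite /truncation normr0 min_l.
apply: le_trans (lerD ua vb); rewrite /truncation.
have K0 := K_ge0; have ab := ler_normD a b.
have a0 := normr_ge0 a; have b0 := normr_ge0 b.
(* If [|a|] or [|b|] exceeds [K], the right side is already at least [K]; otherwise this is the
   triangle inequality. *)
by case: (leP `|a + b| K); case: (leP `|a| K); case: (leP `|b| K) => ? ? ?; lra.
Qed.

Lemma continuous_truncation_sqr : continuous (fun x : R => truncation K x ^+ 2).
Proof.
move=> x; apply: (@continuous_comp _ _ _ (truncation K) (fun y => y ^+ 2)).
  apply: (@continuous_min R R (fun y => `|y|) (fun=> K)).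
    exact: norm_continuous.
  exact: cvg_cst.
exact: exprn_continuous.
Qed.

Lemma bounded_truncation_sqr : bounded_fun (fun x : R => truncation K x ^+ 2).
Proof.
exists (K ^+ 2); split; first exact: num_real.
move=> M /ltW KM x _ /=; apply: le_trans KM.
by rewrite ger0_norm ?sqr_ge0// ler_sqr ?nnegrE ?truncation_ge0 ?truncation_le.
Qed.

Lemma measurable_truncation_sqr :
  measurable_fun setT (fun x : R => truncation K x ^+ 2).
Proof. exact: continuous_measurable_fun continuous_truncation_sqr. Qed.

End Truncation.

(** Monotone convergence: the squared truncations increase to [x ^+ 2] as the level [k] grows. This
    reduces a bound on a possibly infinite moment to bounds on bounded continuous test functions. *)
Lemma second_moment_le (R : realType) (nu : probability (measurableTypeR R) R)
    (b : R) :
  (forall k : nat, (\int[nu]_x (truncation k%:R x ^+ 2)%:E <= b%:E)%E) ->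
  (second_moment nu <= b%:E)%E.
Proof.
move=> le_b; rewrite /second_moment.
pose g (k : nat) (x : measurableTypeR R) := (truncation k%:R (x : R) ^+ 2)%:E.
have cvg_g (x : measurableTypeR R) : limn (g ^~ x) = ((x : R) ^+ 2)%:E.
  apply: cvg_lim => //; apply: cvg_near_cst.
  (* At a fixed [x] the truncation is inactive as soon as [k >= |x|]. *)
  near=> k; rewrite /g /truncation min_l ?real_normK ?num_real//.
  by near: k; exact: nbhs_infty_ger.
rewrite -(eq_integral _ _ (fun x _ => cvg_g x)).
apply: (@cvge_to_le _ \oo _ _ (fun k => \int[nu]_x g k x)%E).
  apply: cvg_monotone_convergence => //.
  - by move=> k; apply/measurable_EFinP; exact: measurable_truncation_sqr.
  - by move=> k x _; rewrite lee_fin sqr_ge0.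
  - move=> x _ k l kl; rewrite lee_fin ler_sqr ?nnegrE ?truncation_ge0//.
    by rewrite /truncation le_min !ge_min lexx /= ler_nat kl orbT.
by near=> k; exact: le_b.
Unshelve. all: by end_near.
Qed.

(** * Minkowski's inequality for limits in distribution *)

Section MinkowskiForLimitLaws.
Context {d : measure_display} {Omega : measurableType d} {R : realType}.
Variable P : probability Omega R.

(** Only expectations of functions of a single [V i n] survive the weighted inequality, so the
    marginal limits suffice. Positivity of [c] is what lets it serve as weights. *)
Lemma second_moment_sum (I : finType) (V : I -> nat -> Omega -> R)
    (nu : probability (measurableTypeR R) R)
    (nus : I -> probability (measurableTypeR R) R) (c : I -> R) :
  (forall i n, measurable_fun setT (V i n)) ->
  cvg_in_distribution P (fun n w => \sum_i V i n w) nu ->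
  (forall i, cvg_in_distribution P (V i) (nus i)) ->
  (forall i, 0 < c i) ->
  (forall i, (second_moment (nus i) <= (c i ^+ 2)%:E)%E) ->
  (second_moment nu <= ((\sum_i c i) ^+ 2)%:E)%E.
Proof.
move=> mV cvgV cvgVi c_gt0 mom_le; apply: second_moment_le => k.
set C := \sum_i c i.
have C_ge0 : 0 <= C by apply: sumr_ge0 => i _; exact: ltW.
pose t (x : R) := truncation k%:R x ^+ 2.
have mt i n : measurable_fun setT (fun w => t (V i n w)).
  by apply: measurableT_comp (mV i n); exact: measurable_truncation_sqr.
have mwt i n :
    measurable_fun setT (fun w => (C / c i)%:E * (t (V i n w))%:E)%E.
  by apply: measurable_funeM; apply/measurable_EFinP.
have mtsum n : measurable_fun setT (fun w => (t (\sum_i V i n w))%:E).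
  apply/measurable_EFinP; apply: measurableT_comp.
    exact: measurable_truncation_sqr.
  exact: measurable_sum.
have weight_ge0 i : 0 <= C / c i by rewrite divr_ge0// ltW.
have contt : continuous t by exact: continuous_truncation_sqr.
have bndt : bounded_fun t by exact: bounded_truncation_sqr.
have rhs_cvg : (\sum_i (C / c i)%:E * \int[P]_w (t (V i n w))%:E)%E @[n --> \oo]
    --> (\sum_i (C / c i)%:E * \int[nus i]_x (t x)%:E)%E.
  apply: cvg_nnesum => i _.
    near=> n; apply: mule_ge0; first by rewrite lee_fin.
    by apply: integral_ge0 => w _; rewrite lee_fin sqr_ge0.
  by apply: cvgeZl => //; exact: cvgVi.
apply: (@le_trans _ _ (\sum_i (C / c i)%:E * \int[nus i]_x (t x)%:E)%E).
  apply: lee_cvg_to (cvgV t contt bndt) rhs_cvg _.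
  near=> n.
  have -> : (\sum_i (C / c i)%:E * \int[P]_w (t (V i n w))%:E =
      \int[P]_w (\sum_i (C / c i)%:E * (t (V i n w))%:E))%E.
    rewrite ge0_integral_sum//; last first.
      by move=> i w _; rewrite -EFinM lee_fin mulr_ge0 ?sqr_ge0.
    apply: eq_bigr => i _; rewrite ge0_integralZl ?lee_fin//.
    - exact/measurable_EFinP.
    - by move=> w _; rewrite lee_fin sqr_ge0.
  apply: ge0_le_integral => //.
  - by move=> w _; rewrite lee_fin sqr_ge0.
  - by apply: emeasurable_sum => i; exact: mwt.
  move=> w _.
  rewrite (eq_bigr (fun i => (C / c i * t (V i n w))%:E))// sumEFin lee_fin.
  (* Cauchy-Schwarz is applied to the truncated values, after subadditivity has moved the truncation
     inside the sum. *)
  apply: le_trans (sqr_sum_le_weighted _ _ c _ c_gt0).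
  rewrite ler_sqr ?nnegrE ?truncation_ge0// ?truncation_sum//.
  by apply: sumr_ge0 => i _; exact: truncation_ge0.
(* With these weights the bounds [c i ^+ 2] recombine to exactly [C ^+ 2], so nothing is lost. *)
have -> : C ^+ 2 = \sum_i C / c i * c i ^+ 2.
  rewrite expr2 {2}/C mulr_sumr; apply: eq_bigr => i _.
  by rewrite expr2 mulrA divfK ?gt_eqF.
rewrite -sumEFin; apply: lee_sum => i _; rewrite [leRHS]EFinM.
apply: lee_wpmul2l; first by rewrite lee_fin.
apply: le_trans (mom_le i); apply: ge0_le_integral => //.
- by move=> x _; rewrite lee_fin sqr_ge0.
- by apply/measurable_EFinP; exact: measurable_truncation_sqr.
- by apply/measurable_EFinP; exact: measurable_funX.
- by move=> x _; rewrite lee_fin truncation_sqr_le.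
Unshelve. all: by end_near.
Qed.

End MinkowskiForLimitLaws.

(** * Pathwise consequences of the scheduling rule *)

Section Policies.
Context {d : measure_display} {Omega : measurableType d} {R : realType}.
Variables (P : probability Omega R) (N : nat).
Variables (X : 'I_N -> nat -> Omega -> bool) (a : nat -> Omega -> option 'I_N).
Hypothesis policy_a : scheduling_policy X a.

(** At most one client is served per slot, and its channel is ON. *)
Lemma sum_received_le (S : {set 'I_N}) (t : nat) (w : Omega) : (0 < t)%N ->
  \sum_(i in S) received a i t w <= some_on X S t w :> R.
Proof.
move=> /(policy_a.2 _ w); rewrite /received /some_on.
case: (a t w) => [j Xj|_]; last by rewrite big1 ?ler0n// => i _.
have [jS|jS] := boolP (j \in S); last first.
  rewrite big1 ?ler0n// => i iS; case: eqP => // -[ij].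
  by rewrite ij iS in jS.
rewrite (bigD1 j)//= eqxx big1 ?addr0 => [|i /andP[_ ij]]; last first.
  by rewrite -[_ == _]/(j == i) eq_sym (negbTE ij).
by rewrite ler_nat (bigD1 j)//= Xj leq_max.
Qed.

(** The converse bound holds because the AP idles only when every channel is OFF. *)
Lemma sum_received (t : nat) (w : Omega) : (0 < t)%N ->
  \sum_i received a i t w = some_on X [set: 'I_N]%SET t w :> R.
Proof.
move=> t_gt0; apply/le_anti/andP; split.
  have := sum_received_le [set: 'I_N]%SET t w t_gt0.
  by under eq_bigl do rewrite finset.in_setT.
have := policy_a.2 _ w t_gt0; rewrite /received /some_on.
case: (a t w) => [j _|noX].
  rewrite [leRHS](bigD1 j)//= eqxx [X in _ + X]big1 ?addr0;
    last first => [i ij|].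
    by rewrite -[_ == _]/(j == i) eq_sym (negbTE ij).
  by rewrite ler_nat; apply/bigmax_leqP => i _; case: (X i t w).
rewrite (_ : (\max_(i in [set: 'I_N]%SET) X i t w)%N = 0%N) ?sumr_ge0//.
by apply: big1 => i _; rewrite (negbTE (noX i)).
Qed.

Lemma measurable_received (i : 'I_N) (t : nat) : (0 < t)%N ->
  measurable_fun setT (received a i t : Omega -> R).
Proof.
move=> t_gt0.
rewrite (_ : received a i t = \1_[set w | a t w = Some i]).
  exact: measurable_indic (policy_a.1 _ _ t_gt0).
apply/funext => w; rewrite /received indicE; congr (nat_of_bool _)%:R.
by apply/eqP/idP; rewrite inE.
Qed.

Lemma measurable_normalized_received (mu : R) (i : 'I_N) (T : nat) :
  measurable_fun setT (normalized_sum (received a i) mu T).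
Proof.
apply: measurable_funM => //; apply: measurable_funB => //.
(* Shifting the index makes every slot visibly positive, as measurability of the policy requires. *)
under eq_fun do rewrite big_add1 big_mkord.
by apply: measurable_sum => t; exact: measurable_received.
Qed.

Lemma sum_normalized_received (mu : 'I_N -> R) (T : nat) (w : Omega) :
  \sum_i normalized_sum (received a i) (mu i) T w =
  normalized_sum (some_on X [set: 'I_N]%SET) (\sum_i mu i) T w.
Proof.
rewrite /normalized_sum -mulr_suml; congr (_ / _).
rewrite sumrB -mulr_sumr; congr (_ - _).
rewrite exchange_big; apply: eq_big_nat => t /andP[t_gt0 _].
exact: sum_received.
Qed.

(** The limits are constants, so a single sample path on which all averages converge is enough. It
    exists because finitely many almost sure events meet in a nonempty set. *)
Lemma ae_time_average_bounds (m : {set 'I_N} -> R) (mu : 'I_N -> R) :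
  (forall S, time_average_cvg P (some_on X S) (m S)) ->
  (forall i, time_average_cvg P (received a i) (mu i)) ->
  [/\ forall S : {set 'I_N}, \sum_(i in S) mu i <= m S,
      \sum_i mu i = m [set: 'I_N]%SET &
      forall i, 0 <= mu i].
Proof.
move=> cvgX cvga.
have P_gt0 : (0 < P setT)%E by rewrite probability_setT.
have aeP := ae_properfilter_algebraOfSetsType P_gt0.
have [w [Xw aw]] := filter_ex
  (filterI (filter_forall _ cvgX) (filter_forall _ cvga)).
have cvg_sum (S : {set 'I_N}) : (\sum_(1 <= t < T.+1)
    \sum_(i in S) (received a i t w : R)) / T%:R @[T --> \oo]
    --> \sum_(i in S) mu i.
  under eq_fun do rewrite exchange_big mulr_suml.
  by apply: (@cvg_big R _ +%R 0 _ (@add_continuous R)) => i _; exact: aw.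
split.
- move=> S; apply: ler_cvg_to (cvg_sum S) (Xw S) _.
  near=> T; rewrite ler_wpM2r ?invr_ge0//.
  by apply: ler_sum_nat => t /andP[t_gt0 _]; exact: sum_received_le.
- have -> : \sum_i mu i = \sum_(i in [set: 'I_N]%SET) mu i.
    by apply: eq_bigl => i; rewrite finset.in_setT.
  have eq_on T : \sum_(1 <= t < T.+1)
      \sum_(i in [set: 'I_N]%SET) (received a i t w : R) =
      \sum_(1 <= t < T.+1) some_on X [set: 'I_N]%SET t w.
    apply: eq_big_nat => t /andP[t_gt0 _]; rewrite -sum_received//.
    by apply: eq_bigl => i; rewrite finset.in_setT.
  have := cvg_sum [set: 'I_N]%SET; under eq_fun do rewrite eq_on.
  by move=> cvg_on; apply: cvg_unique cvg_on (Xw _).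
- move=> i; apply: cvgr_to_ge (aw i) _.
  by near=> T; rewrite divr_ge0// sumr_ge0.
Unshelve. all: by end_near.
Qed.

End Policies.

(** * Necessary conditions on the delivery model *)

Theorem theorem2 (R : realType) (d : measure_display) (Omega : measurableType d)
    (P : probability Omega R) (N : nat) (X : 'I_N -> nat -> Omega -> bool)
    (m v2 : {set 'I_N} -> R) (mu sigma2 : 'I_N -> R)
    (HX : markov_channels P X)
    (Hmodel : second_order_channel_model P X m v2)
    (Hsigma2 : forall i, 0 <= sigma2 i) :
  second_order_capacity_region P X (mu, sigma2) ->
  [/\ forall S : {set 'I_N}, \sum_(i in S) mu i <= m S,
      \sum_i mu i = m [set: 'I_N]%SET,
      \sum_i Num.sqrt (sigma2 i) >= Num.sqrt (v2 [set: 'I_N]%SET) &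
      forall i, 0 <= mu i].
Proof.
move=> [a [policy_a deliv]].
have [le_m eq_m mu_ge0] := ae_time_average_bounds P N X a policy_a m mu
  (fun S => (Hmodel S).1) (fun i => (deliv i).1).
split=> //.
have /choice[nus nusP] := fun i => (deliv i).2.
have [nu [cvg_nu nu2]] := (Hmodel [set: 'I_N]%SET).2.
apply/ler_addgt0Pr => e e_gt0.
(* The slack keeps [c i] positive even when [sigma2 i] is 0. Dividing by [N.+1] covers [N = 0] and
   keeps the total slack at most [e]. *)
pose c i := Num.sqrt (sigma2 i) + e / N.+1%:R.
have eN_gt0 : 0 < e / N.+1%:R :> R by rewrite divr_gt0.
have c_gt0 i : 0 < c i by rewrite ltr_wpDl.
have v2_le : v2 [set: 'I_N]%SET <= (\sum_i c i) ^+ 2.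
  rewrite -lee_fin -nu2.
  apply: (second_moment_sum P _
    (fun i => normalized_sum (received a i) (mu i)) nu nus) => //.
  - by move=> i n; exact: measurable_normalized_received policy_a _ _ _.
  (* By [eq_m] the centrings add up to the channel mean, so the summed deliveries inherit the limit
     law [nu] of the channel model. *)
  - under eq_fun do under eq_fun do
      rewrite (sum_normalized_received N X a policy_a) eq_m.
    exact: cvg_nu.
  - by move=> i; exact: (nusP i).1.
  - move=> i; apply: le_trans (nusP i).2 _; rewrite lee_fin /=.
    rewrite -[leLHS]sqr_sqrtr// ler_sqr ?nnegrE ?sqrtr_ge0 ?ltW//.
    by rewrite ltrDl.
have c_ge0 : 0 <= \sum_i c i by apply: sumr_ge0 => i _; exact: ltW.
apply: (@le_trans _ _ (\sum_i c i)).
  by rewrite -(ger0_norm c_ge0) -sqrtr_sqr ler_wsqrtr.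
rewrite big_split /= lerD2l sumr_const card_ord -[leLHS]mulr_natr.
by rewrite -mulrA ler_piMr ?(ltW e_gt0)// mulrC ler_pdivrMr// mul1r ler_nat.
Qed.
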